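(* Let $k\geq 2$ and $n\geq 2k+1$ be integers, and let $C_n^k$ denote the circulant graph $Ci_n(1,2,\dots,k)$. Then \[ tvs(C_n^k)=\left\lceil\frac{n+2k}{2k+1}\right\rceil. \]
   Context: For integers $n$ and $1\le k\le n/2$, the circulant graph $Ci_n(1,2,\dots,k)$ (the $k$-th power $C_n^k$ of the cycle $C_n$) is the simple graph with vertex set $\{0,1,\dots,n-1\}$ in which $x$ is adjacent to $x\pm i \pmod n$ for every $1\le i\le k$; it is $2k$-regular when $n\ge 2k+1$. For a simple graph $G$, a total labelling $w:V(G)\cup E(G)\to\{1,2,\dots,s\}$ assigns to each vertex $v$ the weighted degree $wd(v)=w(v)+\sum_{e\ni v}w(e)$; the labelling is called (vertex) irregular if the weighted degrees of all vertices are pairwise distinct. The total vertex irregularity strength $tvs(G)$ is the smallest integer $s$ for which such an irregular total labelling with labels in $\{1,\dots,s\}$ exists. *)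

(* Defs.v *)
From mathcomp Require Import all_boot.
Set Implicit Arguments.
Unset Strict Implicit.
Unset Printing Implicit Defensive.

Record sgraph := SGraph {
  vertex :> finType;
  adj : rel vertex;
  adj_sym : symmetric adj;
  adj_irrefl : irreflexive adj }.

Definition edges (G : sgraph) : {set {set G}} :=
  [set [set p.1; p.2] | p : G * G & adj p.1 p.2].

Definition edge (G : sgraph) := {e : {set G} | e \in edges G}.

Definition wd (G : sgraph) (w : G + edge G -> nat) (v : G) : nat :=
  w (inl v) + \sum_(e : edge G | v \in val e) w (inr e).

(* 'I_s.+1 is {0, ..., s}, so positive values in it are the labels 1, ..., s. *)
Definition has_irregular_labelling (G : sgraph) (s : nat) : bool :=
  [exists w : {ffun G + edge G -> 'I_s.+1},
    [forall a, 0 < w a] && injectiveb (wd (fun a => w a : nat))].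

Lemma has_irregular_labellingP (G : sgraph) (s : nat) :
  reflect (exists w : G + edge G -> nat,
             (forall a, 1 <= w a <= s) /\ injective (wd w))
          (has_irregular_labelling G s).
Proof.
apply: (iffP existsP) => [[w /andP[/forallP w0 /injectiveP wI]]|[w [ws wI]]].
  by exists (fun a => w a : nat); split=> // a; rewrite w0 -ltnS ltn_ord.
have wE a : (inord (w a) : 'I_s.+1) = w a :> nat.
  by rewrite inordK // ltnS; case/andP: (ws a).
exists [ffun a => inord (w a)]; apply/andP; split.
  by apply/forallP => a; rewrite ffunE wE; case/andP: (ws a).
apply/injectiveP => u v uv; apply: wI; move: uv; rewrite /wd !ffunE !wE.
by under eq_bigr do rewrite ffunE wE; under [in RHS]eq_bigr do rewrite ffunE wE.
Qed.

Lemma ex_irregular_labelling (G : sgraph) :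
  exists s, has_irregular_labelling G s.
Proof.
pose deg (v : G) := \sum_(e : edge G | v \in val e) 1.
have degE v : deg v <= #|{: edge G}| by rewrite /deg sum1_card max_card.
exists (#|G| + #|{: edge G}|).+1; apply/has_irregular_labellingP.
exists (fun a => if a is inl v then (enum_rank v + (#|{: edge G}| - deg v)).+1
                 else 1).
split=> [[v|e] //=|u v].
  by rewrite ltnS leq_add ?leq_subr // ltnW.
rewrite /wd -/(deg u) -/(deg v) !addSn -!addnA !subnK // => -[] /addIn.
by move/ord_inj/enum_rank_inj.
Qed.

Definition tvs (G : sgraph) : nat := ex_minn (ex_irregular_labelling G).

(* The conjunct [x != y] only matters when n <= k: it keeps the graph simple
   for all n and k. *)
Definition circulant_adj (n k : nat) : rel 'I_n := fun x y =>
  (x != y) && [exists i : 'I_k.+1, (0 < i) &&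
    ((y == (x + i) %% n :> nat) || (x == (y + i) %% n :> nat))].

Lemma circulant_adj_sym n k : symmetric (circulant_adj (n := n) k).
Proof.
move=> x y; rewrite /circulant_adj eq_sym; congr andb.
by apply: eq_existsb => i; rewrite orbC.
Qed.

Lemma circulant_adj_irrefl n k : irreflexive (circulant_adj (n := n) k).
Proof. by move=> x; rewrite /circulant_adj eqxx. Qed.

Definition cycle_power (n k : nat) : sgraph :=
  SGraph (@circulant_adj_sym n k) (@circulant_adj_irrefl n k).

(* Main.v *)
Require Import Defs.
From mathcomp Require Import all_boot all_order all_algebra.
From mathcomp Require Import zify.

(** Every weighted degree lies between [2k+1] and [(2k+1)s], which gives the
    lower bound.  For the upper bound, put [d = 2k+1] and number the vertices in
    zigzag order around the cycle, [0, 1, -1, 2, -2, ...].  A labelling with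
    values in [1, ..., m+1] is a sum of [m] threshold labellings, the one with
    shift [a] giving [1] to the edge [{x, y}] (and to the vertex [x], with
    [y = x]) iff the numbers of [x] and [y] add up to at least [d + 2a].
    As long as [0 <= a <= n - d], the folds at the two ends of the zigzag do not
    matter and the vertex number [i] receives exactly [i - a], clamped to
    [[0, d]].  Taking shifts [min(d r, n - d)] for [r < m], the ramps
    [[a, a + d]] cover the whole range of [i], so that the sum is strictly
    increasing in [i]. *)

Lemma sum_incident_edges (G : sgraph) (F : {set G} -> nat) (v : G) :
  \sum_(e : edge G | v \in val e) F (val e) = \sum_(u | adj v u) F [set v; u].
Proof.
rewrite -(big_sub_cond (op := addn) (mem (edges G)) (fun e => v \in e)).
have -> : \sum_(u | adj v u) F [set v; u]
        = \sum_(u in [set u | adj v u]) F [set v; u].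
  by apply: eq_bigl => u; rewrite inE.
rewrite -(big_imset (h := fun u => [set v; u])) => [|x y] /=; last first.
  rewrite !inE => vx vy /setP/(_ x); rewrite !inE eqxx orbT => /esym/orP[]/eqP //.
  by move=> xv; rewrite xv adj_irrefl in vx.
apply: eq_bigl => e; apply/andP/imsetP => [[/imsetP[[x y] /=]]|[u]].
  rewrite inE /= => xy -> /set2P[] ->; first by exists y; rewrite ?inE.
  by exists x; rewrite ?inE 1?adj_sym // setUC.
rewrite inE => vu ->; rewrite !inE eqxx; split=> //.
by apply/imsetP; exists (v, u); rewrite ?inE.
Qed.

Section CyclePower.
Variables (k n : nat).
Hypothesis hn : 2 * k + 1 <= n.

(** Case distinctions in place of [%%] bring the cyclic arithmetic within reach of [lia]. *)
Lemma modn_lt3 m : m < 3 * n ->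
  m %% n = if m < n then m else if m < 2 * n then m - n else m - 2 * n.
Proof.
move=> lt3; case: ifP => [/modn_small//|/negbT]; rewrite -leqNgt => le1.
case: ifP => [lt2|/negbT]; last rewrite -leqNgt => le2.
  by rewrite -[in LHS](subnK le1) modnDr modn_small //; lia.
rewrite -[in LHS](subnKC le2) modnMDl modn_small //; lia.
Qed.

(* Distance at most [k] on the cycle, for [x, y < n]. *)
Definition near (x y : nat) : bool :=
  (x <= y + k) && (y <= x + k) || (n + y <= x + k) || (n + x <= y + k).

Lemma closed_nbhdE (x y : cycle_power n k) : (y == x) || adj x y = near x y.
Proof.
rewrite /= /circulant_adj (eq_sym y); case: eqVneq => [->|xy] /=.
  by rewrite /near; lia.
have {}xy : x <> y :> nat by move=> /ord_inj/eqP; apply/negP.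
have [ltx lty] := (ltn_ord x, ltn_ord y).
apply/existsP/idP => [[i /andP[i0]]|].
  have lti := ltn_ord i.
  rewrite !modn_lt3; try lia.
  by rewrite /near; do !case: ifP => ?; lia.
rewrite /near => xyk.
have wit i : 0 < i <= k ->
    (y == (x + i) %% n :> nat) || (x == (y + i) %% n :> nat) ->
    exists i : 'I_k.+1, (0 < i) &&
      ((y == (x + i) %% n :> nat) || (x == (y + i) %% n :> nat)).
  by case/andP=> i0 lti E; exists (Ordinal (lti : i < k.+1)); rewrite /= i0.
case/orP: xyk => [/orP[/andP[xy1 xy2]|xy1]|xy1].
- have [le|lt] := leqP x y; [apply: (wit (y - x))|apply: (wit (x - y))]; try lia;
    rewrite !modn_lt3; try lia; do !case: ifP => ?; lia.
- apply: (wit (n + y - x)); rewrite ?modn_lt3; try lia; do !case: ifP => ?; lia.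
- apply: (wit (n + x - y)); rewrite ?modn_lt3; try lia; do !case: ifP => ?; lia.
Qed.

(* [nbr b x] runs through the closed neighbourhood of [x], in increasing or
   decreasing cyclic order according to [b]. *)
Definition nbr (b : bool) (x t : nat) : nat :=
  (if b then x + t + (n - k) else x + (n + k) - t) %% n.

Lemma nbrE b x t : x < n -> t < 2 * k + 1 ->
  nbr b x t = let m := if b then x + t + (n - k) else x + (n + k) - t in
    if m < n then m else if m < 2 * n then m - n else m - 2 * n.
Proof. by move=> ltx ltt; rewrite /nbr modn_lt3 //; case: b; lia. Qed.

Lemma ltn_nbr b x t : nbr b x t < n. Proof. by apply: ltn_pmod; lia. Qed.

Lemma sum_closed_nbhd b (F : nat -> nat) (x : cycle_power n k) :
  F x + \sum_(y | adj x y) F (y : 'I_n) = \sum_(t < 2 * k + 1) F (nbr b x t).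
Proof.
transitivity (\sum_(y : cycle_power n k | (y == x) || adj x y) F (y : 'I_n)).
  rewrite [RHS](bigD1 x) ?eqxx //=; congr (_ + _); apply: eq_bigl => y.
  by case: eqVneq => [->|]; rewrite ?andbT /= ?circulant_adj_irrefl.
pose h (t : 'I_(2 * k + 1)) : 'I_n := Ordinal (ltn_nbr b x t).
have ltx : x < n := ltn_ord x.
have hI : injective h.
  move=> s t [] E; apply: ord_inj; move: E; have := (ltn_ord s, ltn_ord t).
  by case=> lts ltt; rewrite !nbrE //; case: (b) => /=; do !case: ifP => ?; lia.
transitivity (\sum_(y in [set h t | t in setT]) F y); last first.
  rewrite big_imset /=; first by apply: eq_bigl => t; rewrite inE.
  by move=> s t _ _ /hI.
apply: eq_bigl => y; rewrite closed_nbhdE.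
have lty : y < n := ltn_ord y.
apply/idP/imsetP => [|[t _ ->] /=]; last first.
  by have ltt := ltn_ord t; rewrite nbrE // /near; case: (b) => /=;
    do !case: ifP => ?; lia.
rewrite /near => xyk.
(* [s] is the position of [y] in the window from [x - k] up to [x + k]; the decreasing order
   reverses it to [2 * k - s]. *)
have [s les E] : exists2 s, s <= 2 * k &
    [|| x + s == y + k, x + s == y + k + n | x + s + n == y + k].
  case/orP: xyk => [/orP[/andP[xy yx]|xy]|xy];
    [exists (y + k - x) | exists (y + n + k - x) | exists (y + k - x - n)]; lia.
have ltt : (if b then s else 2 * k - s) < 2 * k + 1 by case: (b); lia.
exists (Ordinal ltt) => //; apply: ord_inj; rewrite /= nbrE //.
by case: (b) => /=; do !case: ifP => ?; lia.
Qed.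

Lemma degree_cycle_power (x : cycle_power n k) :
  \sum_(e : edge (cycle_power n k) | x \in val e) 1 = 2 * k.
Proof.
rewrite (sum_incident_edges _ (fun _ => 1)).
have := sum_closed_nbhd true (fun _ => 1) x.
by rewrite (sum_nat_const 'I__) card_ord; lia.
Qed.

Lemma irregular_labelling_bound s :
  has_irregular_labelling (cycle_power n k) s -> n + 2 * k <= (2 * k + 1) * s.
Proof.
case/has_irregular_labellingP => w [ws wI].
have wd_bounds v : 2 * k + 1 <= wd w v <= (2 * k + 1) * s.
  have : 2 * k <= \sum_(e : edge (cycle_power n k) | v \in val e) w (inr e)
         <= 2 * k * s.
    rewrite -(degree_cycle_power v) big_distrl /=.
    by apply/andP; split; apply: leq_sum => e _; rewrite ?mul1n;
      case/andP: (ws (inr e)).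
  by rewrite /wd mulnDl; have := ws (inl v); lia.
(* The right-hand side counts the integers from [2k + 1] to [(2k + 1)s]. *)
have lt_wd v : wd w v - (2 * k + 1) < ((2 * k + 1) * s - 2 * k).
  by have := wd_bounds v; lia.
have : injective (fun v => Ordinal (lt_wd v)).
  move=> u v [] E; apply: wI; move: (wd_bounds u) (wd_bounds v) E; lia.
move/leq_card; rewrite card_ord /= card_ord; lia.
Qed.

(** From a vertex to its number, not back; truncated subtraction gives vertex [0] the number [0]. *)
Definition zigzag (p : nat) : nat :=
  if 2 * p <= n then 2 * p - 1 else 2 * (n - p).

(** Vertex [0] goes with the falling side, whose numbers are even. *)
Definition rising (p : nat) : bool := (0 < p) && (2 * p <= n).

Lemma ltn_zigzag p : p < n -> zigzag p < n.
Proof. by rewrite /zigzag; case: ifP; lia. Qed.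

Lemma zigzag_inj : {in gtn n &, injective zigzag}.
Proof. by move=> p q; rewrite !inE /zigzag; do !case: ifP; lia. Qed.

(* Both sides of the zigzag are traversed in the direction in which the zigzag
   number grows by 2; this holds for the neighbours only away from the ends, but
   the threshold tells no difference there. *)
Lemma zigzag_threshold a x t : x < n -> a + (2 * k + 1) <= n -> t < 2 * k + 1 ->
  (2 * k + 1 + 2 * a <= zigzag x + zigzag (nbr (rising x) x t)) =
  (2 * k + 1 + a <= zigzag x + t).
Proof.
move=> ltx lea ltt; have lty := ltn_nbr (rising x) x t.
have := nbrE (rising x) x t ltx ltt; move: (nbr _ _ _) lty => y lty /=.
(* Away from the ends [y] has number [zigzag x + 2t - 2k]; halving [4k + 1 + 2a <= 2(zigzag x + t)]
   rounds the bound up to [2k + 1 + a]. *)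
rewrite /rising /zigzag; case: (posnP x) => [->|x0] /=.
  by do !case: ifP => ?; lia.
by case: (leqP (2 * x) n) => ? /=; do !case: ifP => ?; lia.
Qed.

Lemma sum_leq_ord (d c : nat) : \sum_(t < d) (c <= t) = d - c.
Proof. by elim: d => [|d IHd]; rewrite ?big_ord0 // big_ord_recr /= IHd; lia. Qed.

Variable m : nat.
Hypothesis hm : n <= (2 * k + 1) * m + 1.

Definition shift (r : nat) : nat := minn ((2 * k + 1) * r) (n - (2 * k + 1)).

Definition label (z : nat) : nat :=
  1 + \sum_(r < m) (2 * k + 1 + 2 * shift r <= z).

Definition labelling (a : cycle_power n k + edge (cycle_power n k)) : nat :=
  match a with
  | inl v => label (2 * zigzag v)
  | inr e => label (\sum_(x in val e) zigzag (x : 'I_n))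
  end.

Lemma label_bounds z : 1 <= label z <= m.+1.
Proof.
rewrite /label add1n /= ltnS -[X in _ <= X]muln1 -[X in _ <= X * _]card_ord.
by rewrite -sum_nat_const; apply: leq_sum => r _; apply: leq_b1.
Qed.

Lemma labelling_bounds a : 1 <= labelling a <= m.+1.
Proof. by case: a => ?; apply: label_bounds. Qed.

(** By truncated subtraction each summand is [i - shift r] clamped to [[0, 2k + 1]]. *)
Definition weight (i : nat) : nat :=
  \sum_(r < m) (2 * k + 1 - (2 * k + 1 + shift r - i)).

Lemma wd_labelling (v : cycle_power n k) :
  wd labelling v = 2 * k + 1 + weight (zigzag v).
Proof.
have ltv : v < n := ltn_ord v.
rewrite /wd /= (sum_incident_edges (cycle_power n k)
  (fun e => label (\sum_(x in e) zigzag (x : 'I_n)))).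
under eq_bigr => u vu.
  rewrite big_setU1 /= ?big_set1; last first.
    by rewrite inE; apply: contraTneq vu => ->; rewrite adj_irrefl.
  over.
(* The vertex label becomes the term [y = v] of a sum over the closed neighbourhood. *)
rewrite mul2n -addnn.
rewrite (sum_closed_nbhd (rising v) (fun y => label (zigzag v + zigzag y))).
rewrite big_split /= sum_nat_const card_ord muln1 exchange_big; congr (_ + _).
apply: eq_bigr => r _; rewrite -[RHS]sum_leq_ord; apply: eq_bigr => t _.
by rewrite zigzag_threshold //; [congr nat_of_bool| rewrite /shift]; lia.
Qed.

(** For [r = i %/ (2k + 1)] one has [shift r <= i < shift r + (2k + 1)], so this summand grows
    strictly; the others are monotone. *)
Lemma weight_ltn i : i.+1 < n -> weight i < weight i.+1.
Proof.
move=> lti; have ltq : i %/ (2 * k + 1) < m by rewrite ltn_divLR; lia.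
rewrite /weight (bigD1 (Ordinal ltq)) //= [X in _ < X](bigD1 (Ordinal ltq)) //=.
rewrite -addSn; apply: leq_add; last by apply: leq_sum => r _; lia.
have := divn_eq i (2 * k + 1); have : i %% (2 * k + 1) < 2 * k + 1.
  by rewrite ltn_mod; lia.
rewrite /shift; lia.
Qed.

Lemma weight_inj : {in gtn n &, injective weight}.
Proof.
have mono : {in gtn n &, {homo weight : i j / i < j}}.
  apply: homo_ltn_in => [y x z|i j|i]; [exact: ltn_trans| |]; rewrite !inE.
    by move=> _ jn l /andP[_ lj]; apply: ltn_trans jn.
  by move=> _ /weight_ltn.
move=> i j ni nj E; case: (ltngtP i j) => // lt.
  by have := mono i j ni nj lt; rewrite E ltnn.
by have := mono j i nj ni lt; rewrite E ltnn.
Qed.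

Lemma irregular_labelling_exists :
  has_irregular_labelling (cycle_power n k) m.+1.
Proof.
apply/has_irregular_labellingP; exists labelling; split.
  exact: labelling_bounds.
move=> u v; rewrite !wd_labelling => /addnI.
have [ltu ltv] : u < n /\ v < n by split; apply: ltn_ord.
move/weight_inj => /(_ (ltn_zigzag _ ltu) (ltn_zigzag _ ltv)).
by move/(zigzag_inj _ _ ltu ltv)/ord_inj.
Qed.

End CyclePower.

(** Adding [2k] to [n + 2k] turns the floor division into the ceiling. *)
Lemma tvs_cycle_power (k n : nat) : 2 * k + 1 <= n ->
  tvs (cycle_power n k) = ((n + 4 * k) %/ (2 * k + 1)).
Proof.
move=> hn; rewrite /tvs; case: ex_minnP => s sP sM.
have d0 : 0 < 2 * k + 1 by lia.
have lo := irregular_labelling_bound k n hn s sP.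
have := leq_divM (n + 4 * k) (2 * k + 1); have := ltn_ceil (n + 4 * k) d0.
case: (_ %/ _) => [|m] hi le; first by lia.
(* This restates [n + 4k < (m + 2)(2k + 1)], the maximality of the quotient [m + 1]. *)
have hm : n <= (2 * k + 1) * m + 1 by lia.
have := sM _ (irregular_labelling_exists k n hn m hm); nia.
Qed.

Import GRing.Theory Num.Theory.
Local Open Scope ring_scope.

Theorem theorem1p2 (k n : nat) (hk : (2 <= k)%N) (hn : (2 * k + 1 <= n)%N) :
  Posz (tvs (cycle_power n k)) =
  Num.ceil ((n + 2 * k)%N%:R / (2 * k + 1)%N%:R : rat).
Proof.
rewrite tvs_cycle_power //; symmetry; apply: ceil_def.
set q := (_ %/ _)%N.
have d0 : (0 < (2 * k + 1)%N%:R :> rat) by rewrite ltr0n; lia.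
have h1 : (q * (2 * k + 1) <= n + 4 * k)%N by apply: leq_divM.
have h2 : (n + 4 * k < q.+1 * (2 * k + 1))%N by rewrite -ltn_divLR; lia.
rewrite ltr_pdivlMr // ler_pdivrMr // -!pmulrn -natrM ler_nat.
rewrite rmorphB /= -!pmulrn mulrBl mul1r ltrBlDr -natrM -natrD ltr_nat.
lia.
Qed.
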